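(* Let $\gamma$ be a half-area $2n$-polygon such that no opposite sides $\gamma(i)\gamma(i+1)$ and $\gamma(i+n)\gamma(i+n+1)$ are parallel. (a) If $\bar\gamma$ is a half-area $2n$-polygon with $\mathcal{E}(\bar\gamma)=\mathcal{E}(\gamma)$ and $\mathcal{M}(\bar\gamma)=\mathcal{M}(\gamma)$, then there is a constant $c\in\mathbb{R}$ such that $\bar\gamma(i)=(1-c)\gamma(i)+c\,\gamma(i+n)$ for all $i$. (b) Conversely, for any constant $c\in\mathbb{R}$, the polygon $\bar\gamma$ defined by $\bar\gamma(i)=(1-c)\gamma(i)+c\,\gamma(i+n)$ for all $i$ satisfies $\mathcal{E}(\bar\gamma)=\mathcal{E}(\gamma)$ and $\mathcal{M}(\bar\gamma)=\mathcal{M}(\gamma)$.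
   Context: Indices are taken modulo $2n$. A half-area $2n$-polygon is a convex polygon with $2n$ vertices $\gamma(1),\dots,\gamma(2n)\in\mathbb{R}^2$, listed in cyclic order along its boundary (collinear consecutive vertices are allowed), such that, for every $i$, the line $l(i)$ through the opposite vertices $\gamma(i)$ and $\gamma(i+n)$ divides the polygonal region into two parts of equal area. The discrete envelope $\mathcal{E}(\gamma)$ is the polygon with vertices $\mathcal{E}(i+\tfrac12)=l(i)\cap l(i+1)$, where $l(i)$ is the line through $\gamma(i)$ and $\gamma(i+n)$ (here $i+\tfrac12$ is just a label for the side from $\gamma(i)$ to $\gamma(i+1)$). The mid-points envelope $\mathcal{M}(\gamma)$ is the polygon with vertices $\mathcal{M}(i)=\tfrac12(\gamma(i)+\gamma(i+n))$. The envelopes of $\bar\gamma$ are defined in the same way from the points $\bar\gamma(i)$. Equality of envelopes of $\gamma$ and $\bar\gamma$ means equality of the vertices with the same index.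
   Formalization: In (b), equality of the discrete envelopes is asserted only for c ≠ 1/2, since for c = 1/2 the points γ̄(i) and γ̄(i+n) coincide and the lines defining E(γ̄) do not exist; equality of the mid-points envelopes is asserted for every c. *)

(* Defs.v *)
From HB Require Import structures.
From mathcomp Require Export all_boot all_order all_algebra.
From mathcomp Require Export all_classical all_reals all_analysis.

Set Implicit Arguments.
Unset Strict Implicit.
Unset Printing Implicit Defensive.

Import Order.TTheory GRing.Theory Num.Theory.

Local Open Scope classical_set_scope.
Local Open Scope ring_scope.

(* [R^o] gives the plane its R-module structure componentwise. *)
Definition plane (R : realType) := (R^o * R^o)%type.

(* Families of 2n points, with indices modulo 2n.  Since 'Z_m is the ring of
   integers modulo m only for 1 < m, this is used under the hypothesis 1 < n
   (a polygon with 2n vertices has n >= 2).  The opposite of index i is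
   i + n%:R. *)
Definition family (R : realType) (n : nat) := 'Z_(2 * n) -> plane R.

Section PlaneGeometry.
Variable R : realType.
Implicit Types A B C P u v : plane R.

Definition area (S : set (plane R)) : \bar R :=
  (@lebesgue_measure R \x @lebesgue_measure R)%E S.

Definition cross u v : R := u.1 * v.2 - u.2 * v.1.

(* Twice the signed area of ABC: positive iff ABC is counterclockwise. *)
Definition orient A B C : R := cross (B - A) (C - A).

Definition parallel u v : Prop := cross u v = 0.

Definition line A B : set (plane R) :=
  [set P | exists t : R, P = (1 - t) *: A + t *: B].

Definition left_side A B : set (plane R) := [set P | 0 <= orient A B P].
Definition right_side A B : set (plane R) := [set P | orient A B P <= 0].

End PlaneGeometry.

Section Polygons.
Variables (R : realType) (n : nat).
Implicit Types g : family R n.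

(* The polygonal region: the convex hull of the vertices. *)
Definition region g : set (plane R) :=
  [set P | exists w : 'Z_(2 * n) -> R,
     [/\ forall i, 0 <= w i, \sum_i w i = 1 & P = \sum_i w i *: g i]].

(* Distinct points, not all on one line, that are met in the order of their
   indices when the boundary of their convex hull is traversed
   counterclockwise (first disjunct) or clockwise (second disjunct).  The
   inequalities are weak, so that consecutive vertices may be collinear. *)
Definition convex_polygon g : Prop :=
  [/\ injective g,
      exists i j k : 'Z_(2 * n), orient (g i) (g j) (g k) != 0 &
      (forall i j k : 'Z_(2 * n), (i < j < k)%N ->
         0 <= orient (g i) (g j) (g k)) \/
      (forall i j k : 'Z_(2 * n), (i < j < k)%N ->
         orient (g i) (g j) (g k) <= 0)].

Definition half_area_polygon g : Prop :=
  convex_polygon g /\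
  forall i : 'Z_(2 * n), area (region g `&` left_side (g i) (g (i + n%:R))) =
            area (region g `&` right_side (g i) (g (i + n%:R))).

Definition opposite_line g (i : 'Z_(2 * n)) : set (plane R) := line (g i) (g (i + n%:R)).

(* [E i] is the vertex with label i + 1/2.  The equality of sets includes the
   requirement that the two lines meet in exactly one point. *)
Definition discrete_envelope g (E : family R n) : Prop :=
  forall i : 'Z_(2 * n), opposite_line g i `&` opposite_line g (i + 1) = [set E i].

(* Both envelopes are well defined, with the same vertices. *)
Definition same_discrete_envelope g1 g2 : Prop :=
  exists E : family R n, discrete_envelope g1 E /\ discrete_envelope g2 E.

Definition midpoints_envelope g : family R n :=
  fun i => 2^-1 *: (g i + g (i + n%:R)).

End Polygons.

(* Main.v *)
Require Import Defs.
From mathcomp Require Import ring lra zify.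

Set Implicit Arguments.
Unset Strict Implicit.
Unset Printing Implicit Defensive.

Import Order.TTheory GRing.Theory Num.Theory.
Import numFieldNormedType.Exports.

Local Open Scope classical_set_scope.
Local Open Scope ring_scope.

(** Write [a], [b], [c], [d] for the vertices of indices [i], [i + 1], [i + n],
    [i + n + 1], [w = c - a] and [v = d - b] for the two chords, and [m] for the
    difference of the mid-points of the second and of the first chord.

    The half-area condition enters only through [half_area_side]: the triangles
    [abc] and [bcd], which have the side [bc] in common, have the same signed
    area, which amounts to [cross m (v + w) = 0]; and the chords are not
    parallel, so that the discrete envelope exists.  Indeed the two chords cut
    off from the region two pieces of equal area, which are the triangles [abc]
    and [bcd] added to one and the same piece, the part of the region beyond
    [bc].  That triangles on a common base with the same area have the same
    height is deduced from the invariance of the area under the transvections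
    that fix the base: a lower triangle is carried by such a map into a higher
    one, of which it misses a part of positive area.

    For the converse part, the affine combinations move the two end points of
    each chord symmetrically about its mid-point; unless [c = 2^-1] they remain
    distinct and span the same line, so that neither envelope changes.

    For the direct part, the hypothesis on opposite sides says that
    [cross m (v - w)] is nonzero.  Together with [cross m (v + w) = 0] it keeps
    the mid-point of a chord off the next chord line.  The mid-point and the
    envelope point thus determine the chord line, and each chord of [gbar] is a
    multiple [mu i] of the chord of [gamma] with the same index.  Then
    [cross m (mu i *: w + mu (i + 1) *: v) = 0] for [gbar], and comparison with
    [cross m (w + v) = 0] gives [mu i = mu (i + 1)]: the ratio is constant. *)

(** * Coordinates and orientation *)

Section Coordinates.
Variable R : realType.
Implicit Types A B C P : plane R.

(** The coordinates of a point, retyped from [R^o] to [R]: algebraic identities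
    between them then only involve the operations of [R]. *)
Definition px P : R := P.1.
Definition py P : R := P.2.

Lemma plane_eq A B : px A = px B -> py A = py B -> A = B.
Proof. by case: A B => [? ?] [? ?]; rewrite /px /py /= => -> ->. Qed.

Lemma pxD A B : px (A + B) = px A + px B. Proof. by []. Qed.
Lemma pyD A B : py (A + B) = py A + py B. Proof. by []. Qed.
Lemma pxN A : px (- A) = - px A. Proof. by []. Qed.
Lemma pyN A : py (- A) = - py A. Proof. by []. Qed.
Lemma pxZ k A : px (k *: A) = k * px A. Proof. by []. Qed.
Lemma pyZ k A : py (k *: A) = k * py A. Proof. by []. Qed.
Lemma px_pair (x y : R) : px (x, y) = x. Proof. by []. Qed.
Lemma py_pair (x y : R) : py (x, y) = y. Proof. by []. Qed.

Definition planeE := (pxD, pyD, pxN, pyN, pxZ, pyZ, px_pair, py_pair).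

Lemma crossE A B : cross A B = px A * py B - py A * px B.
Proof. by []. Qed.

Lemma orientE A B P : orient A B P =
  (px B - px A) * (py P - py A) - (py B - py A) * (px P - px A).
Proof. by []. Qed.

Lemma orient_affine A B P : orient A B P =
  (py A - py B) * px P + (px B - px A) * py P + (px A * py B - py A * px B).
Proof. by rewrite orientE; ring. Qed.

Lemma orient_neq A B C : orient A B C != 0 -> [/\ A != B, B != C & A != C].
Proof.
by split; apply: contra_neq H => ->; rewrite orientE; ring.
Qed.

Lemma orient_rot A B C : orient B C A = orient A B C.
Proof. by rewrite !orientE; ring. Qed.

Lemma orient_swap A B C : orient B A C = - orient A B C.
Proof. by rewrite !orientE; ring. Qed.

Lemma orient_sum A B C P :
  orient A B C = orient A B P + orient B C P + orient C A P.
Proof. by rewrite !orientE; ring. Qed.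

Lemma left_side_swap A B : left_side B A = right_side A B.
Proof.
by apply/seteqP; split=> P; rewrite /left_side /right_side /= (orient_swap A B) oppr_ge0.
Qed.

Lemma right_side_swap A B : right_side B A = left_side A B.
Proof. by rewrite left_side_swap. Qed.

Lemma orient_eq0_sides A B :
  [set P | orient A B P = 0] = left_side A B `&` right_side A B.
Proof.
apply/seteqP; split=> P; rewrite /left_side /right_side /=; first by move=> ->.
by move=> [l r]; apply/le_anti; rewrite l r.
Qed.

Lemma sqr_dist_neq0 A B : A != B ->
  (px B - px A) ^+ 2 + (py B - py A) ^+ 2 != 0.
Proof.
rewrite paddr_eq0 ?sqr_ge0 // !sqrf_eq0 !subr_eq0; apply: contra => /andP[/eqP x /eqP y].
exact/eqP/plane_eq.
Qed.

Lemma collinear_orient A B C : A != B -> orient A B C = 0 ->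
  exists t, forall P, orient A C P = t * orient A B P.
Proof.
move=> AB h0; have := sqr_dist_neq0 AB; set w := (_ + _) => w0.
(* [s] is the coordinate of [C] on the line [AB], by orthogonal projection. *)
pose s := ((px B - px A) * (px C - px A) + (py B - py A) * (py C - py A)) / w.
have ws : w * s = (px B - px A) * (px C - px A) + (py B - py A) * (py C - py A).
  by rewrite /s mulrCA divff // mulr1.
exists s => P; apply: (mulfI w0); rewrite mulrA ws.
apply: subr0_eq.
transitivity (((py B - py A) * (py P - py A) + (px B - px A) * (px P - px A)) *
   (- orient A B C)); last by rewrite h0 oppr0 mulr0.
by rewrite /w !orientE; ring.
Qed.

End Coordinates.

(** * Area in the plane *)

Section PlaneMeasure.
Variable R : realType.
Implicit Types (S U : set (plane R)) (A B C P : plane R).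

(** Measurability for the product of the Borel structures of the two axes, the
    one to which [area] refers. *)
Definition mplane S : Prop :=
  @measurable _ (measurableTypeR R * measurableTypeR R)%type S.

Lemma area_ge0 S : (0 <= area S)%E.
Proof. exact: (measure_ge0 (@lebesgue_measure R \x @lebesgue_measure R)%E). Qed.

Lemma mplaneI S U : mplane S -> mplane U -> mplane (S `&` U).
Proof. exact: measurableI. Qed.

Lemma mplaneD S U : mplane S -> mplane U -> mplane (S `\` U).
Proof. exact: measurableD. Qed.

Lemma le_area S U : mplane S -> mplane U -> S `<=` U -> (area S <= area U)%E.
Proof.
move=> mS mU SU.
by apply: (le_measure (@lebesgue_measure R \x @lebesgue_measure R)%E);
  rewrite ?inE.
Qed.

Lemma areaU S U : mplane S -> mplane U -> S `&` U = set0 ->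
  area (S `|` U) = (area S + area U)%E.
Proof.
exact: (measureU (@lebesgue_measure R \x @lebesgue_measure R)%E).
Qed.

Definition box (a b c d : R) : set (plane R) :=
  [set P | (a <= px P <= b) && (c <= py P <= d)].

Lemma box_setX (a b c d : R) : box a b c d = `[a, b]%classic `*` `[c, d]%classic.
Proof.
by apply/seteqP; split=> P /=; rewrite !in_itv /=; [move/andP|move=> [? ?]; apply/andP].
Qed.

Lemma mplane_box (a b c d : R) : mplane (box a b c d).
Proof. by rewrite box_setX; apply: measurableX; exact: measurable_itv. Qed.

Lemma area_box (a b c d : R) : a <= b -> c <= d ->
  area (box a b c d) = ((b - a) * (d - c))%:E.
Proof.
move=> ab cd; rewrite box_setX.
transitivity (@lebesgue_measure R `[a, b]%classic * @lebesgue_measure R `[c, d]%classic)%E.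
  by apply: product_measure1E.
have itvE (x y : R) : x <= y -> @lebesgue_measure R `[x, y]%classic = (y - x)%:E.
  rewrite lebesgue_measure_itv /= lte_fin le_eqVlt => /predU1P[->|->//].
  by rewrite ltxx subrr.
by rewrite !itvE.
Qed.

Lemma measurable_affine (a b c : R) :
  measurable_fun setT (fun P : measurableTypeR R * measurableTypeR R =>
    a * P.1 + b * P.2 + c : measurableTypeR R).
Proof.
apply: measurable_realfun.measurable_funD; last exact: measurable_cst.
apply: measurable_realfun.measurable_funD; apply: measurable_realfun.measurable_funM.
- exact: measurable_cst.
- exact: measurable_fst.
- exact: measurable_cst.
- exact: measurable_snd.
Qed.

Lemma mplane_affine_preim (a b c : R) (V : set (measurableTypeR R)) : measurable V ->
  mplane [set P | V (a * px P + b * py P + c)].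
Proof.
by move=> mV; have := measurable_affine a b c measurableT mV; rewrite setTI.
Qed.

Lemma mplane_left A B : mplane (left_side A B).
Proof.
have := mplane_affine_preim (py A - py B) (px B - px A) (px A * py B - py A * px B)
  (measurable_itv `[0, +oo[).
by congr mplane; apply/seteqP; split=> P /=; rewrite /left_side /= orient_affine in_itv /= andbT.
Qed.

Lemma mplane_right A B : mplane (right_side A B).
Proof. by rewrite -left_side_swap; exact: mplane_left. Qed.

Lemma mplane_orient_eq0 A B : mplane [set P | orient A B P = 0].
Proof.
rewrite orient_eq0_sides; exact: mplaneI (mplane_left A B) (mplane_right A B).
Qed.

(** The shifted measure and the Lebesgue measure agree on intervals, which
    determine a measure on the line. *)
Lemma lebesgue_measure_shift (t : R) (V : set (measurableTypeR R)) : measurable V ->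
  lebesgue_measure [set y | V (y + t)] = lebesgue_measure V.
Proof.
move=> mV.
pose f : measurableTypeR R -> measurableTypeR R := fun y => y + t.
have mf : measurable_fun setT f.
  by apply: measurable_realfun.measurable_funD => //; exact: measurable_cst.
pose mfR : {mfun measurableTypeR R >-> measurableTypeR R} := mfun_Sub (mem_set mf).
have H := @lebesgue_measure_unique R (pushforward (@lebesgue_measure R) mfR).
symmetry; apply: H => // X [[a b] _ <-{X}].
rewrite /pushforward /=.
transitivity (@lebesgue_measure R `]a - t, b - t]%classic); last first.
  congr lebesgue_measure.
  by apply/seteqP; split=> y /=; rewrite !in_itv /= ltrBlDr lerBrDr.
rewrite /= !lebesgue_measure_itv /= !lte_fin ltrD2r.
by case: ifP => // _; rewrite -!EFinB; congr EFin; ring.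
Qed.

(** The two orders of integration define the same measure, so that sections by
    horizontal lines can be used as well as sections by vertical lines. *)
Lemma area_horizontal_sections S : mplane S ->
  area S = (@lebesgue_measure R \x^ @lebesgue_measure R)%E S.
Proof.
by apply: product_measure_unique => V W mV mW; exact: product_measure2E.
Qed.

(** A vertical shear translates each section by a vertical line. *)
Lemma area_vshear (k t : R) S : mplane S ->
  area [set P | S (px P, py P + (k * px P + t))] = area S.
Proof.
move=> mS; apply: eq_integral => x _ /=.
rewrite -[RHS](lebesgue_measure_shift (k * x + t)); last exact: measurable_xsection.
by congr lebesgue_measure; apply/seteqP; split=> y /=; rewrite /xsection /= !inE.
Qed.

Lemma mplane_affine_map (a b c a' b' c' : R) S : mplane S ->
  mplane [set P | S (a * px P + b * py P + c, a' * px P + b' * py P + c')].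
Proof.
move=> mS.
have := measurable_fun_pair (measurable_affine a b c) (measurable_affine a' b' c').
by move=> /(_ measurableT S mS); rewrite setTI.
Qed.

Lemma mplane_vshear (k t : R) S : mplane S ->
  mplane [set P | S (px P, py P + (k * px P + t))].
Proof.
move/(mplane_affine_map 1 0 0 k 1 t); congr mplane.
by apply/seteqP; split=> P /=; (have -> : 1 * px P + 0 * py P + 0 = px P by ring);
  (have -> : k * px P + 1 * py P + t = py P + (k * px P + t) by ring).
Qed.

Lemma mplane_hshear (k t : R) S : mplane S ->
  mplane [set P | S (px P + (k * py P + t), py P)].
Proof.
move/(mplane_affine_map 1 k t 0 1 0); congr mplane.
by apply/seteqP; split=> P /=; (have -> : 0 * px P + 1 * py P + 0 = py P by ring);
  (have -> : 1 * px P + k * py P + t = px P + (k * py P + t) by ring).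
Qed.

Lemma area_hshear (k t : R) S : mplane S ->
  area [set P | S (px P + (k * py P + t), py P)] = area S.
Proof.
move=> mS; rewrite !area_horizontal_sections //; last exact: mplane_hshear.
apply: eq_integral => y _ /=.
rewrite -[RHS](lebesgue_measure_shift (k * y + t)); last exact: measurable_ysection.
by congr lebesgue_measure; apply/seteqP; split=> x /=; rewrite /ysection /= !inE.
Qed.

(** The affine shear along the line [AB]: it fixes this line pointwise and moves
    each other point parallel to it, proportionally to the distance. *)
Definition transvection A B (k : R) P : plane R :=
  P + (k * orient A B P) *: (B - A).

(** When [AB] is not horizontal, a horizontal shear makes it vertical, and
    conjugates the transvection to a vertical shear. *)
Lemma area_transvection A B (k : R) S : A != B -> mplane S ->
  area [set P | S (transvection A B k P)] = area S.
Proof.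
move=> AB mS; have [w0|w0] := eqVneq (py B - py A) 0.
  rewrite -(area_hshear (k * (px B - px A) ^+ 2) (- k * (px B - px A) ^+ 2 * py A) mS).
  congr area; apply/funext => P /=; congr S.
  apply: plane_eq; rewrite /transvection !(planeE, orientE) w0; ring.
pose r := (px B - px A) / (py B - py A).
pose S2 := [set Q : plane R | S (px Q + (r * py Q + 0), py Q)].
have mS2 : mplane S2 by exact: mplane_hshear.
pose w := py B - py A.
pose S1 := [set Q : plane R | S2 (px Q, py Q + (- k * w ^+ 2 * px Q + k * w ^+ 2 * (px A - r * py A)))].
have mS1 : mplane S1 by exact: mplane_vshear.
rewrite -(area_hshear r 0 mS) -/S2 -(area_vshear (- k * w ^+ 2) (k * w ^+ 2 * (px A - r * py A)) mS2).
rewrite -/S1 -(area_hshear (- r) 0 mS1).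
congr area; apply/funext => P; rewrite /S1 /S2 /=; congr S.
by apply: plane_eq; rewrite /transvection !(planeE, orientE) /r /w; field; exact: w0.
Qed.

(** A line meets each vertical line in one point, unless it is itself vertical;
    in that case it meets each horizontal line in one point. *)
Lemma area_line A B : A != B -> area [set P | orient A B P = 0] = 0%E.
Proof.
move=> AB; have mL := mplane_orient_eq0 A B.
have set1E (f : R -> R) (a b : R) : a != 0 -> (forall y, f y = a * y + b) ->
    @lebesgue_measure R [set y | f y = 0] = 0%E.
  move=> a0 fE; transitivity (@lebesgue_measure R [set - b / a]); last first.
    exact: lebesgue_measure_set1.
  congr lebesgue_measure; apply/seteqP; split=> y /=; rewrite fE.
    by move=> e; apply: (mulfI a0); rewrite mulrCA divff // mulr1; lra.
  by move=> ->; rewrite mulrCA divff //; ring.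
have [e|ne] := eqVneq (px A) (px B).
  rewrite area_horizontal_sections //; apply: integral0_eq => y _ /=.
  have a0 : py A - py B != 0.
    by rewrite subr_eq0; apply: contra_neq AB => e2; exact: plane_eq.
  rewrite -[RHS](set1E (fun x => orient A B (x, y)) _ ((px B - px A) * y + (px A * py B - py A * px B)) a0).
    by congr lebesgue_measure; apply/seteqP; split=> x /=; rewrite /ysection /= !inE.
  by move=> x; rewrite orient_affine !planeE; ring.
apply: integral0_eq => x _ /=.
have a0 : px B - px A != 0 by rewrite subr_eq0 eq_sym.
rewrite -[RHS](set1E (fun y => orient A B (x, y)) _ ((py A - py B) * x + (px A * py B - py A * px B)) a0).
  by congr lebesgue_measure; apply/seteqP; split=> y /=; rewrite /xsection /= !inE.
by move=> y; rewrite orient_affine !planeE; ring.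
Qed.

Lemma area_line_sub A B S : A != B -> mplane S -> (forall P, S P -> orient A B P = 0) ->
  area S = 0%E.
Proof.
move=> AB mS SL; apply/eqP; rewrite eq_le area_ge0 andbT -(area_line AB).
exact: le_area mS (mplane_orient_eq0 A B) SL.
Qed.

Lemma area_split A B S : A != B -> mplane S ->
  area S = (area (S `&` left_side A B) + area (S `&` right_side A B))%E.
Proof.
move=> AB mS.
have mL := mplane_left A B; have mR := mplane_right A B.
have mSL := mplaneI mS mL; have mSnL := mplaneD mS mL.
have mSLR := mplaneI mS (mplaneI mL mR).
have -> : area (S `&` right_side A B) = area (S `\` left_side A B).
  have -> : S `&` right_side A B =
      (S `\` left_side A B) `|` (S `&` (left_side A B `&` right_side A B)).
    apply/seteqP; split=> P; rewrite /left_side /right_side /=.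
      by move=> [SP RP]; have [LP|/negP LP] := boolP (0 <= orient A B P); [right|left].
    by move=> [[SP /negP]|[? []//]]; rewrite -ltNge => /ltW.
  rewrite areaU //; last by apply/seteqP; split=> P //= [[_ +] [_ []]].
  rewrite [X in (_ + X)%E](area_line_sub AB) ?adde0 // => P [_ []].
  by rewrite /left_side /right_side /= => ? ?; apply/eqP; rewrite eq_le; apply/andP.
by rewrite -areaU ?setUIDK //; apply/seteqP; split=> P //= [[_ +] []].
Qed.

End PlaneMeasure.

(** * Triangles of equal area on a common base *)

Section Triangles.
Variable R : realType.
Implicit Types (S K : set (plane R)) (A B C D P : plane R).

(** The triangle [ABC] when its vertices are listed counterclockwise. *)
Definition tri A B C : set (plane R) :=
  left_side A B `&` (left_side B C `&` left_side C A).

Lemma mplane_tri A B C : mplane (tri A B C).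
Proof. by apply: mplaneI; [|apply: mplaneI]; exact: mplane_left. Qed.

Lemma orient_transvection A B C D P k :
  orient (transvection A B k C) (transvection A B k D) (transvection A B k P) =
  orient C D P.
Proof. by rewrite /transvection !(orientE, planeE); ring. Qed.

Lemma transvection_l A B k : transvection A B k A = A.
Proof. by apply: plane_eq; rewrite /transvection !(orientE, planeE); ring. Qed.

Lemma transvection_r A B k : transvection A B k B = B.
Proof. by apply: plane_eq; rewrite /transvection !(orientE, planeE); ring. Qed.

(** The vertices [C] and [D] lie on a parallel to the base [AB], so that a
    transvection along [AB] takes [C] to [D]. *)
Lemma area_tri_shear A B C D : 0 < orient A B C -> orient A B D = orient A B C ->
  area (tri A B C) = area (tri A B D).
Proof.
move=> h0 hD; have [AB _ _] := orient_neq (lt0r_neq0 h0).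
have := sqr_dist_neq0 AB; set w := (_ + _) => w0.
pose s := ((px B - px A) * (px D - px C) + (py B - py A) * (py D - py C)) / w.
have e : D = C + s *: (B - A).
  have ws : w * s = (px B - px A) * (px D - px C) + (py B - py A) * (py D - py C).
    by rewrite /s mulrCA divff // mulr1.
  have cr : (px B - px A) * (py D - py C) = (py B - py A) * (px D - px C).
    by move: hD; rewrite !orientE; lra.
  apply: plane_eq; rewrite !planeE; apply: (mulfI w0); rewrite mulrDr mulrA ws /w.
    apply: subr0_eq.
    transitivity ((py B - py A) * ((py B - py A) * (px D - px C) - (px B - px A) * (py D - py C))).
      by ring.
    by rewrite cr subrr mulr0.
  apply: subr0_eq.
  transitivity ((px B - px A) * ((px B - px A) * (py D - py C) - (py B - py A) * (px D - px C))).
    by ring.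
  by rewrite cr subrr mulr0.
pose k := s / orient A B C.
have TC : transvection A B k C = D.
  by rewrite /transvection /k divfK ?lt0r_neq0.
rewrite -(area_transvection k AB (mplane_tri A B D)); congr area.
apply/funext => P; rewrite /tri /left_side /=.
rewrite -(orient_transvection A B A B P k) -(orient_transvection A B B C P k).
by rewrite -(orient_transvection A B C A P k) TC transvection_l transvection_r.
Qed.

(** A square centred at the centroid, small with respect to the height, lies in
    the triangle. *)
Lemma area_tri_gt0 A B C : 0 < orient A B C -> (0 < area (tri A B C))%E.
Proof.
move=> h0; set h := orient A B C in h0.
pose M := `|px A| + `|py A| + `|px B| + `|py B| + `|px C| + `|py C| + 1.
have M0 : 0 < M by rewrite /M ltr_pwDr // !addr_ge0.
(* Along each side, [orient] is [h / 3] at the centroid, and its two partial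
   derivatives are bounded by [2 * M]. *)
pose e := h / (12 * M).
have e0 : 0 < e by rewrite divr_gt0 // mulr_gt0.
pose G : plane R := ((px A + px B + px C) / 3, (py A + py B + py C) / 3).
pose K := box (px G - e) (px G + e) (py G - e) (py G + e).
have small (x y : R) : `|x| <= 2 * M -> `|y| <= e -> `|x * y| <= h / 6.
  move=> hx hy; rewrite normrM (le_trans (ler_pM _ _ hx hy)) //.
  by rewrite /e le_eqVlt; apply/orP; left; apply/eqP; field; rewrite lt0r_neq0.
have edge U V P : K P -> orient U V G = h / 3 -> `|px U| + `|px V| <= M ->
    `|py U| + `|py V| <= M -> left_side U V P.
  move=> /andP[hx hy] hG hpx hpy; rewrite /left_side /=.
  have -> : orient U V P = orient U V G +
      (py U - py V) * (px P - px G) + (px V - px U) * (py P - py G).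
    by rewrite !orientE; ring.
  have b1 : `|(py U - py V) * (px P - px G)| <= h / 6.
    by apply: small; [rewrite (le_trans (ler_normB _ _)) //|rewrite ler_norml]; lra.
  have b2 : `|(px V - px U) * (py P - py G)| <= h / 6.
    by apply: small; [rewrite (le_trans (ler_normB _ _)) //|rewrite ler_norml]; lra.
  move: b1 b2; rewrite hG !ler_norml => /andP[b1 _] /andP[b2 _]; lra.
have n1 := normr_ge0 (px A); have n2 := normr_ge0 (py A).
have n3 := normr_ge0 (px B); have n4 := normr_ge0 (py B).
have n5 := normr_ge0 (px C); have n6 := normr_ge0 (py C).
have sub : K `<=` tri A B C.
  by move=> P KP; split; [|split]; apply: (edge _ _ _ KP); rewrite /M; try lra;
    rewrite /h !(orientE, planeE); field.
apply: lt_le_trans (le_area (mplane_box _ _ _ _) (mplane_tri A B C) sub).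
rewrite area_box; [|lra|lra].
by rewrite lte_fin mulr_gt0 //; lra.
Qed.

(** The point [E] of [BD] at the height of [C] splits the triangle [ABD] into
    [ABE], with the area of [ABC], and [AED], with a positive area. *)
Lemma area_tri_lt A B C D : (area (tri A B D) < +oo)%E ->
  0 < orient A B C -> orient A B C < orient A B D ->
  (area (tri A B C) < area (tri A B D))%E.
Proof.
move=> fin h0 hlt; set h := orient A B C in h0 hlt; set h' := orient A B D in hlt.
have h'0 : 0 < h' by exact: lt_trans hlt.
pose r := h / h'.
have r0 : 0 < r by rewrite divr_gt0.
have r1 : r < 1 by rewrite ltr_pdivrMr // mul1r.
pose E := B + r *: (D - B).
have hE : orient A B E = h.
  transitivity (r * h'); last by rewrite /r divfK // lt0r_neq0.
  by rewrite /E /h' !(orientE, planeE); ring.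
have hEP P : orient A E P = (1 - r) * orient A B P - r * orient D A P.
  by rewrite /E !(orientE, planeE); ring.
have hED : orient A E D = (1 - r) * h'.
  by rewrite /E /h' !(orientE, planeE); ring.
have hED0 : 0 < orient A E D by rewrite hED mulr_gt0 // subr_gt0.
have hBE P : orient B E P = r * orient B D P.
  by rewrite /E !(orientE, planeE); ring.
have hEDP P : orient E D P = (1 - r) * orient B D P.
  by rewrite /E !(orientE, planeE); ring.
have [AE _ _] := orient_neq (lt0r_neq0 hED0).
rewrite (area_tri_shear h0 hE) (area_split AE (mplane_tri A B D)).
have mT := mplane_tri A B D.
have s1 : tri A B E `<=` tri A B D `&` right_side A E.
  move=> P; rewrite /tri /left_side /right_side /= (orient_swap A E) hEP hBE oppr_ge0.
  move=> [h1 [h2 h3]]; rewrite pmulr_rge0 // in h2; split=> //; split=> //; split=> //.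
  have : 0 <= (1 - r) * orient A B P by rewrite mulr_ge0 // subr_ge0 ltW.
  move=> h4; have : 0 <= r * orient D A P by lra.
  by rewrite pmulr_rge0.
have s2 : tri A E D `<=` tri A B D `&` left_side A E.
  move=> P; rewrite /tri /left_side /= hEP hEDP => -[h1 [h2 h3]].
  rewrite pmulr_rge0 ?subr_gt0 // in h2; split=> //; split=> //.
  have : 0 <= r * orient D A P by rewrite mulr_ge0 // ltW.
  move=> h4; have : 0 <= (1 - r) * orient A B P by lra.
  by rewrite pmulr_rge0 // subr_gt0.
have l1 := le_area (mplane_tri A B E) (mplaneI mT (mplane_right A E)) s1.
have l2 := le_area (mplane_tri A E D) (mplaneI mT (mplane_left A E)) s2.
have p2 := area_tri_gt0 hED0.
have fR : area (tri A B D `&` right_side A E) \is a fin_num.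
  rewrite ge0_fin_numE ?area_ge0 //; apply: le_lt_trans fin.
  by apply: le_area => //; exact: mplaneI mT (mplane_right A E).
apply: le_lt_trans l1 _.
by rewrite -[ltLHS]add0e lteD2rE // (lt_le_trans p2).
Qed.

Lemma area_tri_eq A B C D : (area (tri A B C) < +oo)%E -> (area (tri A B D) < +oo)%E ->
  0 < orient A B C -> 0 < orient A B D -> area (tri A B C) = area (tri A B D) ->
  orient A B C = orient A B D.
Proof.
move=> fC fD hC hD e; have [lt|lt|//] := ltgtP (orient A B C) (orient A B D).
  by have := area_tri_lt fD hC lt; rewrite e ltxx.
by have := area_tri_lt fC hD lt; rewrite e ltxx.
Qed.

End Triangles.

(** * Quadrilaterals spanned by two halving chords *)

Section Halving.
Variable R : realType.
Implicit Types (S : set (plane R)) (A B C D P : plane R).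

Lemma tri_rot A B C : tri B C A = tri A B C.
Proof. by rewrite /tri setIA setIC. Qed.

(** Convexity, in the form that triangles call for. *)
Definition convex3 S : Prop := forall A B C, S A -> S B -> S C ->
  forall x y z : R, 0 <= x -> 0 <= y -> 0 <= z -> x + y + z = 1 ->
  S (x *: A + y *: B + z *: C).

(** Barycentric coordinates are quotients of values of [orient]. *)
Lemma tri_sub S A B C : convex3 S -> S A -> S B -> S C -> 0 < orient A B C ->
  tri A B C `<=` S.
Proof.
move=> cS SA SB SC h0 P [h1 [h2 h3]]; rewrite /left_side /= in h1 h2 h3.
have n0 := lt0r_neq0 h0; have hs := orient_sum A B C P.
have -> : P = (orient B C P / orient A B C) *: A + (orient C A P / orient A B C) *: B
   + (orient A B P / orient A B C) *: C.
  apply: plane_eq; rewrite !planeE; apply: (mulfI n0); rewrite !mulrDr !mulrA -!(mulrC (orient A B C)^-1)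
    !mulrA mulVf // !mul1r !orientE; ring.
apply: cS => //; try by rewrite divr_ge0 // ltW.
rewrite -!mulrDl; apply: (mulIf n0); rewrite divfK // mul1r hs.
by rewrite addrC addrA.
Qed.

Definition halves A B S : Prop :=
  area (S `&` left_side A B) = area (S `&` right_side A B).

Lemma halves_swap A B S : halves A B S -> halves B A S.
Proof. by move=> h; rewrite /halves (left_side_swap A B) (right_side_swap A B); apply/esym. Qed.

Lemma fin_area_sub S U : mplane S -> mplane U -> U `<=` S ->
  (area S < +oo)%E -> area U \is a fin_num.
Proof.
move=> mS mU US fS; rewrite ge0_fin_numE; last exact: area_ge0.
exact: le_lt_trans (le_area mU mS US) fS.
Qed.

(** Otherwise the half on the right lies on the line [AB], so both halves are
    null. *)
Lemma halves_not_left A B S : mplane S -> area S != 0%E -> A != B ->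
  halves A B S -> ~ S `<=` left_side A B.
Proof.
move=> mS S0 AB hS SL; move/eqP: S0; apply.
have R0 : area (S `&` right_side A B) = 0%E.
  apply: (area_line_sub AB); first exact: mplaneI mS (mplane_right A B).
  move=> P [/SL]; rewrite /left_side /right_side /= => l r.
  by apply/le_anti; rewrite l r.
by rewrite (area_split AB mS) hS R0 adde0.
Qed.

(** If [C] were on the line [AB], that line would be a halving line with the
    whole region on one side. *)
Lemma halves_noncollinear A B C S : mplane S -> area S != 0%E -> A != B -> A != C ->
  halves A C S -> S `<=` left_side A B \/ S `<=` right_side A B -> orient A B C != 0.
Proof.
move=> mS S0 AB AC hS sup; apply/eqP => /(collinear_orient AB)[t ht].
have CA : C != A by rewrite eq_sym.
have nL := halves_not_left mS S0 AC hS.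
have nR := halves_not_left mS S0 CA (halves_swap hS).
have [t0|/ltW t0] := leP 0 t; case: sup => sup; [apply: nL|apply: nR|apply: nR|apply: nL] => P /sup;
  rewrite /left_side /right_side /= ?(orient_swap A C) ?oppr_ge0 ht => h.
- exact: mulr_ge0.
- exact: mulr_ge0_le0.
- exact: mulr_le0_ge0.
- exact: mulr_le0.
Qed.

Lemma halves_area A B C D S : mplane S -> (area S < +oo)%E -> A != B -> C != D ->
  halves A B S -> halves C D S ->
  area (S `&` right_side A B) = area (S `&` right_side C D).
Proof.
move=> mS fS AB CD h1 h2.
have := area_split AB mS; rewrite h1 (area_split CD mS) h2.
have fin E F : area (S `&` right_side E F) \is a fin_num.
  exact: fin_area_sub mS (mplaneI mS (mplane_right E F)) (@subIsetl _ _ _) fS.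
move: (fin A B) (fin C D).
move: (area (S `&` right_side A B)) (area (S `&` right_side C D)).
by case=> [x| |] // [y| |] // _ _ [xy]; congr EFin; lra.
Qed.

(** The chords [AC] and [BD] both halve [S], and the sides [AB] and [CD] support
    it.  Beyond the line [BC] lies a piece of [S] that is also beyond [AC] and
    beyond [BD]; the half of [S] beyond [AC] is this piece plus the triangle
    [ABC], the half beyond [BD] is this piece plus the triangle [BCD].  So these
    triangles on the base [BC] have the same area, hence the same height. *)
Lemma halved_quadrilateral S A B C D :
  mplane S -> (area S < +oo)%E -> area S != 0%E -> convex3 S ->
  S A -> S B -> S C -> S D -> A != B -> C != D -> A != C -> B != D ->
  S `<=` left_side A B -> S `<=` left_side C D ->
  halves A C S -> halves B D S ->
  [/\ 0 < orient A B C, 0 < orient A C D & orient A B C = orient B C D].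
Proof.
move=> mS fS S0 cS SA SB SC SD AB CD AC BD sAB sCD hAC hBD.
have BA : B != A by rewrite eq_sym.
have DC : D != C by rewrite eq_sym.
have CA : C != A by rewrite eq_sym.
have DB : D != B by rewrite eq_sym.
have rBA : S `<=` right_side B A by rewrite right_side_swap.
have rDC : S `<=` right_side D C by rewrite right_side_swap.
have pos E F G : S G -> S `<=` left_side E F -> orient E F G != 0 -> 0 < orient E F G.
  by move=> SG /(_ G SG); rewrite /left_side /= lt_neqAle eq_sym => -> ->.
have ABC : 0 < orient A B C.
  exact: pos SC sAB (halves_noncollinear mS S0 AB AC hAC (or_introl sAB)).
have ABD : 0 < orient A B D.
  apply: (pos _ _ _ SD sAB); rewrite -oppr_eq0 -orient_swap.
  exact: (halves_noncollinear mS S0 BA BD hBD (or_intror rBA)).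
have CDA : 0 < orient C D A.
  exact: pos SA sCD (halves_noncollinear mS S0 CD CA (halves_swap hAC) (or_introl sCD)).
have CDB : 0 < orient C D B.
  apply: (pos _ _ _ SB sCD); rewrite -oppr_eq0 -orient_swap.
  exact: (halves_noncollinear mS S0 DC DB (halves_swap hBD) (or_intror rDC)).
have BCA : 0 < orient B C A by rewrite orient_rot.
have BCD : 0 < orient B C D by rewrite -orient_rot.
have [BC _ _] := orient_neq (lt0r_neq0 BCD).
have mK := mplaneI mS (mplane_right B C).
have mAC := mplaneI mS (mplane_right A C).
have mBD := mplaneI mS (mplane_right B D).
(* The next two inclusions rest on the three-term relation between the
   determinants of four vectors, drawn from [C] and from [B] respectively. *)
have kAC P : S P -> right_side B C P -> right_side A C P.
  move=> SP rP; move: rP (sCD P SP); rewrite /right_side /left_side /= => rP lP.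
  rewrite leNgt; apply/negP => hP.
  have pl : orient C D A * orient B C P =
     orient C D P * orient A B C + orient C D B * orient A C P.
    by rewrite !orientE; ring.
  have : 0 < orient C D A * orient B C P.
    by rewrite pl; apply: ltr_wpDl; [apply: mulr_ge0 => //; exact: ltW|exact: mulr_gt0].
  by rewrite pmulr_rgt0 // ltNge rP.
have kBD P : S P -> right_side B C P -> right_side B D P.
  move=> SP rP; move: rP (sAB P SP); rewrite /right_side /left_side /= => rP lP.
  rewrite leNgt; apply/negP => hP.
  have pl : orient A B D * orient B C P =
     orient A B P * orient B C D + orient A B C * orient B D P.
    by rewrite !orientE; ring.
  have : 0 < orient A B D * orient B C P.
    by rewrite pl; apply: ltr_wpDl; [apply: mulr_ge0 => //; exact: ltW|exact: mulr_gt0].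
  by rewrite pmulr_rgt0 // ltNge rP.
have sub1 := tri_sub cS SA SB SC ABC.
have sub2 := tri_sub cS SB SC SD BCD.
have s1 : S `&` right_side A C `&` left_side B C = tri A B C.
  apply/seteqP; split=> P.
    by move=> [[SP rP] lP]; split; [exact: sAB|split; [|rewrite (left_side_swap A C)]].
  by move=> tP; have := tP; rewrite /tri (left_side_swap A C) => -[_ [? ?]]; split; [split; [exact: sub1|]|].
have s1' : S `&` right_side A C `&` right_side B C = S `&` right_side B C.
  by apply/seteqP; split=> P; [move=> [[]]|move=> [SP rP]; split; [split; [|exact: kAC]|]].
have s2 : S `&` right_side B D `&` left_side B C = tri B C D.
  apply/seteqP; split=> P.
    by move=> [[SP rP] lP]; split; [|split; [exact: sCD|rewrite (left_side_swap B D)]].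
  by move=> tP; have := tP; rewrite /tri (left_side_swap B D) => -[? [_ ?]]; split; [split; [exact: sub2|]|].
have s2' : S `&` right_side B D `&` right_side B C = S `&` right_side B C.
  by apply/seteqP; split=> P; [move=> [[]]|move=> [SP rP]; split; [split; [|exact: kBD]|]].
have e := halves_area mS fS AC BD hAC hBD.
rewrite (area_split BC mAC) (area_split BC mBD) s1 s1' s2 s2' in e.
have fK := fin_area_sub mS mK (@subIsetl _ _ _) fS.
have f1 := le_lt_trans (le_area (mplane_tri A B C) mS sub1) fS.
have f2 := le_lt_trans (le_area (mplane_tri B C D) mS sub2) fS.
have e3 : area (tri A B C) = area (tri B C D).
  move/(congr1 (fun x => (x - area (S `&` right_side B C))%E)): e.
  by rewrite (addeK _ fK) (addeK _ fK).
split; [exact: ABC|by rewrite -orient_rot|].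
rewrite -orient_rot; apply: area_tri_eq BCA BCD _; last by rewrite tri_rot.
- by rewrite tri_rot; exact: f1.
- exact: f2.
Qed.

End Halving.

(** * The region of a polygon *)

Section Region.
Variable R : realType.

(** An open set is the union of the rectangles with rational bounds that it
    contains. *)
Lemma open_mplane (U : set (R^o * R^o)%type) : open U -> mplane (U : set (plane R)).
Proof.
move=> oU.
pose rbox (q : rat * rat * (rat * rat)) : set (measurableTypeR R * measurableTypeR R) :=
  `]ratr q.1.1, ratr q.1.2[ `*` `]ratr q.2.1, ratr q.2.2[.
pose F q := [set P | rbox q `<=` U /\ rbox q P].
have -> : U = \bigcup_q F q.
  apply/seteqP; split=> [P UP|P [q _ [qU qP]]]; last exact: qU.
  have : nbhs P U by exact: open_nbhs_nbhs.
  case=> -[V W] /= [/nbhs_ballP [e1 /= e10 VP] /nbhs_ballP [e2 /= e20 WP]] VW.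
  have rat2 (x e : R) : 0 < e -> exists q : rat * rat,
      (x \in `]ratr q.1, ratr q.2[) /\
      (forall y, y \in `]ratr q.1, ratr q.2[ -> ball x e y).
    move=> e0.
    have [q1] := @rat_in_itvoo R (x - e) x ltac:(lra).
    have [q2] := @rat_in_itvoo R x (x + e) ltac:(lra).
    rewrite !in_itv /= => /andP[a1 a2] /andP[a3 a4].
    exists (q1, q2); split=> [|y]; rewrite in_itv /=; first by rewrite a4 a1.
    move=> /andP[a5 a6]; rewrite /ball /= ltr_distlC; apply/andP; split; lra.
  have [q [hq qV]] := rat2 P.1 e1 e10.
  have [r [hr rW]] := rat2 P.2 e2 e20.
  exists (q, r) => //; split; last by split.
  move=> Q [Q1 Q2]; apply: VW; split.
    by apply: VP; exact: qV.
  by apply: WP; exact: rW.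
apply: countable_bigcupT_measurable => [|q]; first exact: countableP.
have [qU|nqU] := pselect (rbox q `<=` U).
  have -> : F q = rbox q by apply/seteqP; split=> P //= [].
  by apply: measurableX; exact: measurable_itv.
have -> : F q = set0 by apply/seteqP; split=> P //= [].
exact: measurable0.
Qed.

Lemma compact_mplane (K : set (R^o * R^o)%type) : compact K -> mplane (K : set (plane R)).
Proof.
move=> cK.
have /closed_openC/open_mplane oK : closed K.
  by apply: compact_closed cK; exact: (@norm_hausdorff _ (R^o * R^o)%type).
rewrite -(setCK K); exact: measurableC oK.
Qed.

Variable n : nat.
Implicit Types g : family R n.
Local Notation I := 'Z_(2 * n).

(** The weights of a convex combination of the vertices, as row vectors: their
    compactness makes the region compact, hence measurable. *)
Definition simplex : set 'rV[R^o]_(Zp_trunc (2 * n)).+2 :=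
  [set v | forall i, `[0, 1]%classic (v ord0 i)] `&` [set v | \sum_i v ord0 i = 1].

Lemma compact_simplex : compact simplex.
Proof.
apply: compact_closedI.
  by apply: (@rV_compact R^o _ (fun=> `[0, 1]%classic)) => i; exact: segment_compact.
have cs : continuous (fun v : 'rV[R^o]_(Zp_trunc (2 * n)).+2 => \sum_i v ord0 i : R^o).
  apply: continuous_big => [|i _]; last exact: coord_continuous.
  by move=> x; exact: add_continuous.
apply: ((continuous_closedP _).1 cs [set x | x = 1]); exact: closed_eq.
Qed.

Lemma region_image g : region g =
  (fun v : 'rV[R^o]_(Zp_trunc (2 * n)).+2 => \sum_i v ord0 i *: g i) @` simplex.
Proof.
apply/seteqP; split=> [P [w [w0 w1 ->]]|P [v [v01 v1] <-]].
  exists (\row_i w i); last by apply: eq_bigr => i _; rewrite mxE.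
  split=> [i|] /=.
    rewrite mxE in_itv /= w0 -w1 (bigD1 i) //= lerDl.
    by apply: sumr_ge0.
  by rewrite -[RHS]w1; apply: eq_bigr => i _; rewrite mxE.
exists (fun i => v ord0 i); split=> // i.
by have := v01 i; rewrite /= in_itv /= => /andP[].
Qed.

Lemma mplane_region g : mplane (region g).
Proof.
rewrite region_image; apply: compact_mplane.
apply: continuous_compact; last exact: compact_simplex.
apply: continuous_subspaceT.
apply: (@continuous_big (R^o * R^o)%type) => [|i _].
  by move=> x; exact: add_continuous.
move=> v; apply: (@continuousZr_tmp R (R^o * R^o)%type); exact: coord_continuous.
Qed.

Lemma px_sum (w : I -> R) g : px (\sum_i w i *: g i) = \sum_i w i * px (g i).
Proof. by rewrite (big_morph _ (@pxD R) (erefl : px 0 = 0)). Qed.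

Lemma py_sum (w : I -> R) g : py (\sum_i w i *: g i) = \sum_i w i * py (g i).
Proof. by rewrite (big_morph _ (@pyD R) (erefl : py 0 = 0)). Qed.

Lemma area_region_fin g : (area (region g) < +oo)%E.
Proof.
pose M : R := \sum_i (`|px (g i)| + `|py (g i)|).
have M0 : 0 <= M by apply: sumr_ge0 => i _; exact: addr_ge0.
have key (w : I -> R) (f : I -> R) : (forall i, 0 <= w i) -> \sum_i w i = 1 ->
    (forall i, `|f i| <= `|px (g i)| + `|py (g i)|) -> `|\sum_i w i * f i| <= M.
  move=> w0 w1 hf; apply: le_trans (ler_norm_sum _ _ _) _; apply: ler_sum => i _.
  have wi1 : w i <= 1.
    by rewrite -w1 (bigD1 i) //= lerDl; apply: sumr_ge0.
  rewrite normrM (ger0_norm (w0 i)) (le_trans _ (hf i)) //.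
  by rewrite -[leRHS]mul1r; apply: ler_wpM2r.
have sub : region g `<=` box (- M) M (- M) M.
  move=> P [w [w0 w1 ->]]; rewrite /box /= -!ler_norml.
  apply/andP; split.
    by have := key w (fun i => px (g i)) w0 w1; rewrite px_sum; apply => i; rewrite lerDl.
  by have := key w (fun i => py (g i)) w0 w1; rewrite py_sum; apply => i; rewrite lerDr.
apply: le_lt_trans (le_area (mplane_region g) (mplane_box _ _ _ _) sub) _.
have MM : - M <= M by lra.
rewrite (area_box MM MM); exact: ltry.
Qed.

Lemma region_vertex g i : region g (g i).
Proof.
exists (fun j => (j == i)%:R); split=> [j|//|].
- exact: ler0n.
- by rewrite (bigD1 i) //= eqxx big1 ?addr0 // => j /negPf ->.
- rewrite (bigD1 i) //= eqxx scale1r big1 ?addr0 // => j /negPf ->.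
  by rewrite scale0r.
Qed.

Lemma region_convex3 g : convex3 (region g).
Proof.
move=> _ _ _ [u [u0 u1 ->]] [v [v0 v1 ->]] [w [w0 w1 ->]] x y z x0 y0 z0 xyz.
exists (fun i => x * u i + y * v i + z * w i); split=> [i||].
- by rewrite !addr_ge0 // mulr_ge0.
- by rewrite !big_split -!mulr_sumr /= u1 v1 w1 !mulr1.
- rewrite !scaler_sumr -!big_split; apply: eq_bigr => i _.
  by rewrite !scalerA !scalerDl.
Qed.

Lemma region_left A B g : (forall k, 0 <= orient A B (g k)) ->
  region g `<=` left_side A B.
Proof.
move=> h P [w [w0 w1 ->]]; rewrite /left_side /=.
have -> : orient A B (\sum_i w i *: g i) = \sum_i w i * orient A B (g i).
  transitivity (orient A B (\sum_i w i *: g i) +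
     (\sum_i w i - 1) * (px A * py B - py A * px B)).
    by rewrite w1 subrr mul0r addr0.
  rewrite orient_affine px_sum py_sum !mulr_sumr mulrBl mulr_suml.
  rewrite [RHS](eq_bigr (fun i => (py A - py B) * (w i * px (g i)) +
     (px B - px A) * (w i * py (g i)) + w i * (px A * py B - py A * px B))); last first.
    by move=> i _; rewrite orient_affine; ring.
  by rewrite !big_split /=; ring.
by apply: sumr_ge0 => i _; rewrite mulr_ge0.
Qed.

Lemma area_region_neq0 g : convex_polygon g -> area (region g) != 0%E.
Proof.
move=> [_ [i [j [k o0]]] _].
suff [A [B [C [KA KB KC h0]]]] : exists A B C,
    [/\ region g A, region g B, region g C & 0 < orient A B C].
  have sub := tri_sub (@region_convex3 g) KA KB KC h0.
  rewrite gt_eqF //; apply: lt_le_trans (area_tri_gt0 h0) _.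
  exact: le_area (mplane_tri A B C) (mplane_region g) sub.
have [lt|lt|/eqP e] := ltgtP 0 (orient (g i) (g j) (g k)).
- by exists (g i), (g j), (g k); split=> //; exact: region_vertex.
- exists (g j), (g i), (g k); split; [exact: region_vertex..|].
  by rewrite orient_swap oppr_gt0.
- by rewrite eq_sym e in o0.
Qed.

End Region.

(** * Opposite sides of a half-area polygon *)

Lemma opp_indexK (n : nat) (i : 'Z_(2 * n)) : (1 < n)%N -> i + n%:R + n%:R = i.
Proof.
move=> n_gt1; rewrite -addrA -natrD addnn -mul2n Zp_nat.
rewrite (_ : inZp _ = 0) ?addr0 //; apply/val_inj => /=.
by rewrite Zp_cast ?modnn //; lia.
Qed.

Lemma opp_index_neq (n : nat) (i : 'Z_(2 * n)) : (1 < n)%N -> i != i + n%:R.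
Proof.
move=> n_gt1; rewrite -[X in X == _]addr0 (inj_eq (addrI i)) eq_sym Zp_nat -val_eqE /=.
by rewrite Zp_cast ?modn_small; lia.
Qed.

Section Polygon.
Variables (R : realType) (n : nat).
Local Notation I := 'Z_(2 * n).
Implicit Types g : family R n.

(** The factor [s] is meant to be [1] or [-1], for the two directions of
    traversal.  A rotation of the triple of vertices puts the indices in
    increasing order, also for the side from the last vertex to the first. *)
Lemma side_support (s : R) g :
  (forall i j k : I, (i < j < k)%N -> 0 <= s * orient (g i) (g j) (g k)) ->
  forall i k : I, 0 <= s * orient (g i) (g (i + 1)) (g k).
Proof.
move=> H i k; have [->|ki] := eqVneq k i.
  by rewrite (_ : orient _ _ _ = 0) ?mulr0 // orientE; ring.
have [->|ki1] := eqVneq k (i + 1).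
  by rewrite (_ : orient _ _ _ = 0) ?mulr0 // orientE; ring.
have [i1|i1] : (i + 1 : I) = i.+1 :> nat \/ (i + 1 : I) = 0%N :> nat /\ i = (Zp_trunc (2 * n)).+1 :> nat.
  have := ltn_ord i; rewrite leq_eqVlt => /orP[/eqP[e]|lt]; [right|left].
    by split=> //; rewrite /= e (@modn_small 1) // addn1 modnn.
  by rewrite /= (@modn_small 1) // addn1 modn_small.
  have [lt|ge] := ltnP k i.
    by rewrite -orient_rot -orient_rot; apply: H; rewrite lt i1 ltnSn.
  have lt : (i < k)%N by rewrite ltn_neqAle ge andbT eq_sym val_eqE.
  apply: H; rewrite i1 ltnSn /= ltn_neqAle lt andbT -i1.
  by rewrite eq_sym val_eqE.
case: i1 => i10 ei; rewrite -orient_rot; apply: H.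
apply/andP; split.
  by rewrite i10 lt0n; apply: contra ki1 => /eqP k0; apply/eqP/val_inj; rewrite /= k0.
by rewrite ltn_neqAle val_eqE ki /= ei -ltnS ltn_ord.
Qed.

(** For a polygon traversed clockwise, [halved_quadrilateral] is applied to the
    same four vertices, with those of each of the two sides exchanged.  The sum
    of the two triangles on a diagonal is the [cross] of the diagonals, which is
    thereby nonzero. *)
Lemma half_area_side g i : (1 < n)%N -> half_area_polygon g ->
  orient (g i) (g (i + 1)) (g (i + n%:R)) =
    orient (g (i + 1)) (g (i + n%:R)) (g (i + n%:R + 1)) /\
  cross (g (i + n%:R) - g i) (g (i + n%:R + 1) - g (i + 1)) != 0.
Proof.
move=> n_gt1 [cg hg]; have [ginj _ ord] := cg.
have S0 := area_region_neq0 cg; have mS := mplane_region g.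
have fS := area_region_fin g; have cS := @region_convex3 _ _ g.
have nab (j : I) : g j != g (j + 1) by rewrite (inj_eq ginj) eq_sym -subr_eq0 addrC addKr oner_neq0.
have nac (j : I) : g j != g (j + n%:R) by rewrite (inj_eq ginj) opp_index_neq.
have hac : halves (g i) (g (i + n%:R)) (region g) := hg i.
have hbd : halves (g (i + 1)) (g (i + n%:R + 1)) (region g).
  by rewrite [i + _ + 1]addrAC; exact: hg (i + 1).
have nbd : g (i + 1) != g (i + n%:R + 1) by rewrite [i + _ + 1]addrAC.
have V := region_vertex g.
have [Ho|Ho] := ord.
  have sup (j : I) : region g `<=` left_side (g j) (g (j + 1)).
    apply: region_left => k; rewrite -[orient _ _ _]mul1r.
    by apply: side_support => i' j' k' lt; rewrite mul1r; exact: Ho.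
  have [h1 h2 h3] := halved_quadrilateral mS fS S0 cS (V i) (V (i + 1)) (V (i + n%:R))
    (V (i + n%:R + 1)) (nab _) (nab _) (nac _) nbd (sup _) (sup _) hac hbd.
  split; first exact: h3.
  rewrite gt_eqF //; move: (addr_gt0 h1 h2); congr (_ < _).
  by rewrite crossE !(orientE, planeE); ring.
have sup (j : I) : region g `<=` left_side (g (j + 1)) (g j).
  apply: region_left => k; rewrite orient_swap -mulN1r.
  by apply: side_support => i' j' k' lt; rewrite mulN1r oppr_ge0; exact: Ho.
have nba (j : I) : g (j + 1) != g j by rewrite eq_sym.
have [h1 h2 h3] := halved_quadrilateral mS fS S0 cS (V (i + 1)) (V i) (V (i + n%:R + 1))
   (V (i + n%:R)) (nba _) (nba _) nbd (nac _) (sup _) (sup _) hbd hac.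
split; first by move: h3; rewrite !orientE; lra.
rewrite lt_eqF // -oppr_gt0; move: (addr_gt0 h1 h2); congr (_ < _).
by rewrite crossE !(orientE, planeE); ring.
Qed.

End Polygon.

(** * Chord lines, mid-points and envelope points *)

Section Lines.
Variable R : realType.
Implicit Types A B C D P : plane R.

(** The intersection point of [AB] and [CD], by Cramer's rule. *)
Definition line_meet A B C D : plane R :=
  A + (cross (C - A) (D - C) / cross (B - A) (D - C)) *: (B - A).

Lemma lines_meet A B C D : cross (B - A) (D - C) != 0 ->
  line A B `&` line C D = [set line_meet A B C D].
Proof.
move=> w0; apply/seteqP; split=> P /=.
  move=> [[t Pt] [u Pu]]; have key : t * cross (B - A) (D - C) = cross (C - A) (D - C).
    transitivity (cross (P - A) (D - C)).
      by rewrite Pt !(crossE, planeE); ring.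
    by rewrite Pu !(crossE, planeE); ring.
  rewrite /line_meet -key mulfK // Pt; apply: plane_eq; rewrite !planeE; ring.
move=> ->; split.
  exists (cross (C - A) (D - C) / cross (B - A) (D - C)).
  by apply: plane_eq; rewrite /line_meet !planeE; ring.
exists (cross (C - A) (B - A) / cross (B - A) (D - C)).
apply: plane_eq; apply: (mulfI w0); rewrite /line_meet !planeE;
  move: w0; rewrite !(crossE, planeE) => w0; field; exact: w0.
Qed.

(** The two combinations are symmetric about the mid-point of [AB], and distinct
    when [c] is not [2^-1]. *)
Lemma line_reparam A B (c : R) : c != 2^-1 ->
  line ((1 - c) *: A + c *: B) ((1 - c) *: B + c *: A) = line A B.
Proof.
move=> c2; have w0 : 1 - 2 * c != 0.
  by apply: contra_neq c2 => e; lra.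
apply/seteqP; split=> P [t ->].
  exists (c + t * (1 - 2 * c)); apply: plane_eq; rewrite !planeE; ring.
exists ((t - c) / (1 - 2 * c)); apply: plane_eq; rewrite !planeE; field; exact: w0.
Qed.

(** If the mid-point of [AC] were on [BD], then [A] and [C] would be at the same
    distance from [BD]; with equal triangles [ABC] and [BCD] this makes [AB]
    and [CD] parallel. *)
Lemma midpoint_off_line A B C D P t : orient A B C = orient B C D ->
  cross (B - A) (D - C) != 0 -> P = (1 - t) *: A + t *: C -> line B D P -> t != 2^-1.
Proof.
move=> h n0 e [u Pu]; apply: contra_neq n0 => t2.
have : orient B D P = 0 by rewrite Pu !(orientE, planeE); ring.
rewrite e t2; move: h; rewrite !(orientE, crossE, planeE); lra.
Qed.

(** [ABCD] and [A'B'C'D'] have the same mid-points of [AC] and of [BD].  For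
    fixed mid-points the hypotheses [orient A B C = orient B C D] and its
    analogue are linear in the chords, and a suitable combination of them is
    [(nu - mu) * cross (B - A) (D - C) = 0]. *)
Lemma scaled_chords A B C D A' B' C' D' (mu nu : R) :
  orient A B C = orient B C D -> orient A' B' C' = orient B' C' D' ->
  cross (B - A) (D - C) != 0 ->
  A' + C' = A + C -> B' + D' = B + D ->
  C' - A' = mu *: (C - A) -> D' - B' = nu *: (D - B) -> nu = mu.
Proof.
move=> h h' n0 AC BD dAC dBD; apply/eqP; rewrite -subr_eq0; apply/eqP.
apply: (mulIf n0); rewrite mul0r.
have half P Q X Y (r : R) : P + Q = X -> Q - P = r *: Y -> P = 2^-1 *: (X - r *: Y).
  by move=> <- <-; apply: plane_eq; rewrite !planeE; field.
have half' P Q X Y (r : R) : P + Q = X -> Q - P = r *: Y -> Q = 2^-1 *: (X + r *: Y).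
  by move=> <- <-; apply: plane_eq; rewrite !planeE; field.
transitivity (2 * (orient A' B' C' - orient B' C' D') -
   (mu + nu) * (orient A B C - orient B C D)).
  rewrite (half _ _ _ _ _ AC dAC) (half' _ _ _ _ _ AC dAC).
  rewrite (half _ _ _ _ _ BD dBD) (half' _ _ _ _ _ BD dBD).
  by rewrite !(orientE, crossE, planeE); field.
by rewrite h h' !subrr !mulr0 subrr.
Qed.

End Lines.

(* In the second part, c = 1/2 makes gbar i and gbar (i + n) both equal to the
   mid-point of gamma i and gamma (i + n), so that the lines defining the
   discrete envelope of gbar do not exist; only the mid-points envelope makes
   sense for that value of c. *)
Theorem proposition5p2 (R : realType) (n : nat) (n_gt1 : (1 < n)%N)
    (gamma : family R n) (gamma_half : half_area_polygon gamma)
    (gamma_npar : forall i : 'Z_(2 * n),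
       ~ parallel (gamma (i + 1) - gamma i)
                  (gamma (i + n%:R + 1) - gamma (i + n%:R))) :
  (forall gbar : family R n, half_area_polygon gbar ->
     same_discrete_envelope gbar gamma ->
     midpoints_envelope gbar =1 midpoints_envelope gamma ->
     exists c : R, forall i : 'Z_(2 * n),
       gbar i = (1 - c) *: gamma i + c *: gamma (i + n%:R))
  /\
  (forall (c : R) (gbar : family R n),
     (forall i : 'Z_(2 * n), gbar i = (1 - c) *: gamma i + c *: gamma (i + n%:R)) ->
     (c <> 2^-1 -> same_discrete_envelope gbar gamma) /\
     midpoints_envelope gbar =1 midpoints_envelope gamma).
Proof.
split=> [gbar gbar_half [E [Ebar Egam]] mid|c gbar gbarE].
  have sumE i : gbar i + gbar (i + n%:R) = gamma i + gamma (i + n%:R).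
    have := mid i; rewrite /midpoints_envelope => e.
    have := congr1 (fun P => 2%:R *: P) e.
    by rewrite !scalerA divff ?scale1r.
  have npar i : cross (gamma (i + 1) - gamma i)
      (gamma (i + n%:R + 1) - gamma (i + n%:R)) != 0 by apply/eqP; exact: gamma_npar.
  have /choice[mu muE] : forall i, exists m : R,
      gbar (i + n%:R) - gbar i = m *: (gamma (i + n%:R) - gamma i).
    move=> i; have [h _] := half_area_side i n_gt1 gamma_half.
    have [Eg Eg1] : (opposite_line gamma i `&` opposite_line gamma (i + 1)) (E i).
      by rewrite Egam.
    have [[u Eu] _] : (opposite_line gbar i `&` opposite_line gbar (i + 1)) (E i).
      by rewrite Ebar.
    case: Eg => t Et; rewrite /opposite_line [i + 1 + _]addrAC in Eg1.
    have t2 := midpoint_off_line h (npar i) Et Eg1.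
    (* Both sides are the vector from the common mid-point to [E i]. *)
    have eq_off : (u - 2^-1) *: (gbar (i + n%:R) - gbar i) =
        (t - 2^-1) *: (gamma (i + n%:R) - gamma i).
      transitivity (E i - 2^-1 *: (gbar i + gbar (i + n%:R))).
        by rewrite Eu; apply: plane_eq; rewrite !planeE; field.
      by rewrite sumE Et; apply: plane_eq; rewrite !planeE; field.
    have u2 : u - 2^-1 != 0.
      apply: contra_neq t2 => u0; have [_] := half_area_side i n_gt1 gamma_half.
      move: eq_off; rewrite u0 scale0r => /esym/eqP.
      rewrite scaler_eq0 subr_eq0 => /orP[/eqP->//|/eqP->].
      by rewrite crossE [px 0]/= [py 0]/= !mul0r subrr eqxx.
    exists ((t - 2^-1) / (u - 2^-1)); apply: (scalerI u2).
    by rewrite eq_off scalerA mulrCA divff // mulr1.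
  have muS i : mu (i + 1) = mu i.
    have [h _] := half_area_side i n_gt1 gamma_half.
    have [h' _] := half_area_side i n_gt1 gbar_half.
    apply: (scaled_chords h h' (npar i) (sumE i) _ (muE i)).
      by rewrite ![i + _ + 1]addrAC; exact: sumE.
    by rewrite ![i + _ + 1]addrAC; exact: muE.
  have mu0 i : mu i = mu 0.
    rewrite -(natr_Zp i); elim: (val i) => [//|k IH].
    by rewrite -natr1 muS.
  exists ((1 - mu 0) / 2) => i.
  have := muE i; rewrite mu0; have := sumE i.
  move: (gbar i) (gbar (i + _)) (gamma i) (gamma (i + _)) => A' C' A C s d.
  have -> : A' = 2^-1 *: ((A' + C') - (C' - A')).
    by apply: plane_eq; rewrite !planeE; field.
  by rewrite s d; apply: plane_eq; rewrite !planeE; field.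
have gbarE' i : gbar (i + n%:R) = (1 - c) *: gamma (i + n%:R) + c *: gamma i.
  by rewrite gbarE opp_indexK.
split=> [/eqP c2|i].
  have lineE i : opposite_line gbar i = opposite_line gamma i.
    by rewrite /opposite_line gbarE gbarE' line_reparam.
  pose E i := line_meet (gamma i) (gamma (i + n%:R)) (gamma (i + 1)) (gamma (i + n%:R + 1)).
  have envE : discrete_envelope gamma E.
    move=> i; have [_ n0] := half_area_side i n_gt1 gamma_half.
    by rewrite /opposite_line [i + 1 + _]addrAC lines_meet.
  by exists E; split=> // i; rewrite !lineE.
rewrite /midpoints_envelope gbarE gbarE'.
by apply: plane_eq; rewrite !planeE; ring.
Qed.
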